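(* Let $K$ be a field, $S=K[x_1,\dots,x_n]$, and let $I\subset S$ be a monomial ideal. Then $I$ is matching-matroidal if and only if $I=(P_1\cdots P_t)^{\le{\bf 1}}$ for some monomial prime ideals $P_1,\dots,P_t$.
   Context: Put $[n]=\{1,\dots,n\}$. The monomial prime ideals are the ideals $P_F=(x_i:\ i\in F)$ with $F$ a non-empty subset of $[n]$. Let ${\bf 1}=(1,1,\dots,1)\in\mathbb{Z}_{\ge0}^n$. For a monomial ideal $L\subset S$, its squarefree part $L^{\le{\bf 1}}$ is the monomial ideal generated by all monomials $x_1^{b_1}\cdots x_n^{b_n}\in L$ such that $b_i\le1$ for all $i$. Let $G$ be a finite simple graph on the vertex set $[n]$. A matching of $G$ is a collection of pairwise disjoint edges of $G$. A subset $B\subseteq[n]$ meets a matching $M$ if $B\subseteq\bigcup_{e\in M}e$. For a non-empty subset $A\subseteq[n]$, the collection of all $B\subseteq A$ such that $B$ meets some matching of $G$ is, by a theorem of Edmonds and Fulkerson, the collection of independent sets of a matroid, denoted $\mathrm{Match}(G;A)$ and called a matching-matroid. A squarefree monomial ideal $I$ is called matching-matroidal if the supports $\{i:\ x_i\mid u\}$ of the minimal monomial generators $u$ of $I$ are the bases of a matching-matroid.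
   Formalization: I is assumed nonzero (0 = (P_1P_1)^{≤1} with P_1=(x_1) is not matching-matroidal); the graph G may have further vertices beyond [n] (otherwise (x_1,x_2) with n=2 is a counterexample); t = 0 is allowed, the empty product being S. *)

(* Defs.v *)
From HB Require Import structures.
From mathcomp Require Import all_boot all_order all_algebra.
From mathcomp Require Import mpoly.
From mathcomp Require Import boolp classical_sets.

Set Implicit Arguments.
Unset Strict Implicit.
Unset Printing Implicit Defensive.

Import GRing.Theory.

Section Matchings.

Local Open Scope set_scope.

(* A finite simple graph is an irreflexive symmetric adjacency relation [g]. *)
Variables (V : finType) (g : rel V).

Definition edges : {set {set V}} :=
  [set e : {set V} | [exists x, exists y, g x y && (e == [set x; y])]].

Definition matching (M : {set {set V}}) : bool :=
  (M \subset edges) && finset.trivIset M.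

Definition meets (B : {set V}) (M : {set {set V}}) : bool := B \subset finset.cover M.

Definition match_indep (A : {set V}) : {set {set V}} :=
  [set B : {set V} | (B \subset A) && [exists M, matching M && meets B M]].

(* The bases of a matroid are its inclusion-maximal independent sets. *)
Definition match_bases (A : {set V}) : {set {set V}} :=
  [set B : {set V} | maxset (fun C => C \in match_indep A) B].

End Matchings.

Local Open Scope ring_scope.
Local Open Scope classical_set_scope.

Section Ideals.

Variables (K : fieldType) (n : nat).

Local Notation S := {mpoly K[n]}.

Definition is_ideal (I : set S) : Prop :=
  [/\ I 0, forall p q, I p -> I q -> I (p + q) & forall r p, I p -> I (r * p)].

Definition ideal_gen (X : set S) : set S :=
  [set p | forall J : set S, is_ideal J -> X `<=` J -> J p].

Definition ideal_mul (I J : set S) : set S :=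
  ideal_gen [set pq | exists p q, [/\ I p, J q & pq = p * q]].

Definition monomials_gen (M : set 'X_{1..n}) : set S :=
  ideal_gen [set p | exists2 m, M m & p = 'X_[m]].

Definition monomial_ideal (I : set S) : Prop :=
  exists M : set 'X_{1..n}, I = monomials_gen M.

Definition monomial_prime (P : set S) : Prop :=
  exists2 F : {set 'I_n}, F != finset.set0
    & P = ideal_gen [set p | exists2 i, i \in F & p = 'X_i].

Definition squarefree_mnm (m : 'X_{1..n}) : Prop := forall i, (m i <= 1)%N.

Definition squarefree_monomial_ideal (I : set S) : Prop :=
  exists2 M : set 'X_{1..n}, M `<=` squarefree_mnm & I = monomials_gen M.

Definition squarefree_part (L : set S) : set S :=
  monomials_gen [set m | L 'X_[m] /\ squarefree_mnm m].

Definition min_gen_set (I : set S) (M : set 'X_{1..n}) : Prop :=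
  I = monomials_gen M /\
  forall M' : set 'X_{1..n}, M' `<=` M -> I = monomials_gen M' -> M' = M.

(* A monomial ideal has exactly one minimal set of monomial generators;
   [min_gens I] is that set. *)
Definition min_gens (I : set S) : set 'X_{1..n} :=
  [set u | exists2 M, min_gen_set I M & M u].

Definition mnm_supp (m : 'X_{1..n}) : {set 'I_n} :=
  [set i : 'I_n | m i != 0%N]%SET.

(* The vertices of the graph are [n] together with finitely many further
   vertices; [lshift k] is the inclusion of [n] into [n + k]. With [k = 0]
   imposed, not even (x_1, x_2) in K[x_1, x_2] would be matching-matroidal. *)
Definition matching_matroidal (I : set S) : Prop :=
  squarefree_monomial_ideal I /\
  exists (k : nat) (g : rel 'I_(n + k)) (A : {set 'I_(n + k)}),
    [/\ ssrbool.symmetric g, irreflexive g, A != finset.set0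
      & [set B | B \in match_bases g A] =
        [set B | exists2 u, min_gens I u
                   & B = [set lshift k i | i in mnm_supp u]%SET]].

End Ideals.

(* Main.v *)
Require Import Defs.
From HB Require Import structures.
From mathcomp Require Import all_boot all_order all_algebra.
From mathcomp Require Import mpoly.
From mathcomp Require Import zify.
From mathcomp Require Import boolp classical_sets.

(** The monomials of (P_1 ... P_t)^{<=1} are governed by systems of distinct
    representatives: a generator x_{i_1} ... x_{i_t} with i_j in F_j is
    squarefree exactly when the i_j are distinct, so the ideal is generated by
    the squarefree monomials whose supports are the transversals of
    F_1, ..., F_t ([squarefree_part_prod]).  All transversals have t elements,
    so these monomials form an antichain and are the minimal generators
    ([min_gens_antichain]).  The theorem thus says that the matching-matroids
    are the transversal matroids, presented by as many sets as their rank.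

    A transversal matroid is the matching-matroid of the bipartite graph of its
    presentation, restricted to the side of the elements
    ([transversal_is_matching]); that maximal independent sets are full
    transversals is the theorem of Mendelsohn and Dulmage.

    Conversely, let A be a set of vertices of a graph g.  A relative form of the
    Gallai-Edmonds structure theorem ([critical_barrier]) provides a vertex set
    U and a partition of the other vertices into blocks without edges between
    them, such that
    - a block C contained in A is factor-critical: C minus any one of its
      vertices has a perfect matching;
    - in any other block C, some matching covers C intersected with A;
    - U is matched injectively into the blocks contained in A.
    It is found by maximising the number of odd blocks contained in A minus |U|,
    and then |U|; Hall's theorem and an induction inside the blocks give the
    three properties.

    Each odd block covered by a matching sends an edge of it to U.  Hence a base
    B omits one vertex from each block contained in A that is not joined to U,
    and nothing else.  These sets B are the transversals of the following
    family ([presentation]): the singletons of the elements of A outside the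
    blocks contained in A, |C| - 1 copies of each block C contained in A, and,
    for each u in U, the union of the blocks contained in A that are adjacent to
    u.  A transversal leaves at most one vertex out of each block, and it tells
    which block each u is joined to, so it is independent
    ([presentation_indep]).  An independent set yields an injection from the
    blocks that it contains to U; by Mendelsohn and Dulmage this extends to an
    injection of U into the blocks reaching all of them, from which a
    transversal containing the set is read off ([presentation_extend]). *)

Set Implicit Arguments.
Unset Strict Implicit.
Unset Printing Implicit Defensive.

(** * Systems of distinct representatives *)

Section Hall.
Import mathcomp.boot.fintype mathcomp.boot.finset.
Local Open Scope nat_scope.

Variables (I T : finType) (x0 : T).
Implicit Types (D S : {set I}).

(** Elements are removed from the sets as long as Hall's condition survives.
    When a set F i still has two elements x and y, and removing either breaks the
    condition, there are violating index sets S1 and S2 through i; counting the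
    union over S1 and S2 and the union over their intersection without i
    contradicts the condition, by submodularity. *)
Lemma hall_marriage D (F : I -> {set T}) :
    (forall S, S \subset D -> #|S| <= #|\bigcup_(i in S) F i|) ->
  exists f : I -> T, {in D &, injective f} /\ {in D, forall i, f i \in F i}.
Proof.
have [n] := ubnP (\sum_(i in D) #|F i|); elim: n F => // n IHn F leFn hallF.
have [/forall_inP-small | ] := boolP [forall i in D, #|F i| <= 1].
  have card1 i : i \in D -> #|F i| = 1.
    move=> Di; apply/eqP; rewrite eqn_leq small //=.
    by have := hallF [set i]; rewrite sub1set big_set1 cards1; apply.
  pose f i := odflt x0 [pick x in F i].
  have fE i : i \in D -> F i = [set f i].
    move=> Di; have /cards1P[x Fi] := introT eqP (card1 i Di).
    rewrite /f Fi; case: pickP => [y | /(_ x)]; last by rewrite set11.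
    by move=> /set1P->.
  exists f; split=> [i j Di Dj eqf | i Di]; last by rewrite fE ?set11.
  apply: contraTeq isT => neq_ij.
  have := hallF [set i; j]; rewrite cards2 neq_ij bigcup_setU !big_set1 !fE //.
  by rewrite eqf setUid cards1; apply; apply/subsetP=> k /set2P[]->.
rewrite negb_forall_in => /exists_inP[i Di]; rewrite -ltnNge.
case/card_gt1P=> x [y] [Fx Fy neq_xy].
pose F' z j := if j == i then F i :\ z else F j.
have violated z : z \in F i ->
    (exists f : I -> T, {in D &, injective f} /\ {in D, forall j, f j \in F j})
    \/ exists2 S : {set I}, i \in S /\ S \subset D
         & #|\bigcup_(j in S) F' z j| < #|S|.
  move=> Fz.
  have [/forall_inP/=hallF' | ] :=
      boolP [forall S in powerset D, #|S| <= #|\bigcup_(j in S) F' z j|].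
    left; have [||f [f_inj fF']] := IHn (F' z).
    - rewrite -ltnS; apply: leq_trans leFn; rewrite ltnS (bigD1 i) //= [ltnRHS](bigD1 i) //=.
      rewrite -addSn leq_add //.
        by rewrite /F' eqxx [ltnRHS](cardsD1 z) Fz.
      by apply: leq_sum => j /andP[_ /negPf nij]; rewrite /F' nij.
    - by move=> S sSD; apply: hallF'; rewrite powersetE.
    exists f; split=> // j Dj; have := fF' j Dj; rewrite /F'.
    by case: eqP => // ->; rewrite inE => /andP[].
  rewrite negb_forall_in => /exists_inP[S]; rewrite powersetE -ltnNge => sSD ltS.
  right; exists S => //; split=> //; apply: contraLR ltS => nSi.
  rewrite -leqNgt (leq_trans (hallF _ sSD)) // subset_leq_card //.
  apply/bigcupsP=> j Sj; apply/subsetP=> w Fw; apply/bigcupP; exists j => //.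
  by rewrite /F' (negPf (memPn nSi _ Sj)).
have [//|[S1 [S1i sS1] lt1]] := violated x Fx.
have [//|[S2 [S2i sS2] lt2]] := violated y Fy.
set U1 := \bigcup_(_ in _) _ in lt1; set U2 := \bigcup_(_ in _) _ in lt2.
have leU : #|S1 :|: S2| <= #|U1 :|: U2|.
  apply: leq_trans (hallF _ _) (subset_leq_card _); first by rewrite subUset sS1.
  apply/bigcupsP=> j Sj; apply/subsetP=> w Fw; rewrite inE.
  have [eq_ji | neq_ji] := eqVneq j i.
    rewrite eq_ji in Fw; have [eq_wx | neq_wx] := eqVneq w x.
      apply/orP; right; apply/bigcupP; exists i => //.
      by rewrite /F' eqxx !inE Fw eq_wx neq_xy.
    apply/orP; left; apply/bigcupP; exists i => //.
    by rewrite /F' eqxx !inE Fw neq_wx.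
  by case/setUP: Sj => Sj; apply/orP; [left | right]; apply/bigcupP; exists j;
     rewrite // /F' (negPf neq_ji).
have leI : #|(S1 :&: S2) :\ i| <= #|U1 :&: U2|.
  apply: leq_trans (hallF _ _) (subset_leq_card _).
    by apply/subsetP=> j /setD1P[_ /setIP[/(subsetP sS1)]].
  apply/bigcupsP=> j /setD1P[/negPf neq_ji /setIP[S1j S2j]].
  apply/subsetP=> w Fw; rewrite inE; apply/andP.
  by split; apply/bigcupP; exists j; rewrite // /F' neq_ji.
have cardI : #|S1 :&: S2| = #|(S1 :&: S2) :\ i|.+1.
  by rewrite [LHS](cardsD1 i) inE S1i S2i.
have: #|S1 :|: S2| + #|S1 :&: S2| <= (#|U1 :|: U2| + #|U1 :&: U2|).+1.
  by rewrite cardI addnS ltnS leq_add.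
rewrite !cardsUI => leS.
by have := leq_add lt1 lt2; rewrite addSn addnS ltnNge leS.
Qed.

(** If some e in E is missed by f, then f is redirected to e at h e.  It stays
    injective because e is new, and one more e in E satisfies f (h e) = e, since
    by injectivity of h no other such equation is destroyed. *)
Lemma mendelsohn_dulmage (r : I -> T -> bool) D (E : {set T}) f (h : T -> I) :
    {in D &, injective f} -> {in D, forall i, r i (f i)} ->
    {in E &, injective h} -> {in E, forall e, h e \in D /\ r (h e) e} ->
  exists f', [/\ {in D &, injective f'}, {in D, forall i, r i (f' i)}
               & E \subset f' @: D].
Proof.
move=> f_inj fr h_inj hr.
have [n] := ubnP #|[set e in E | f (h e) != e]|.
elim: n f f_inj fr => // n IHn f f_inj fr ltn.
have [sE | ] := boolP (E \subset f @: D); first by exists f.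
case/subsetPn=> e Ee fDe; have [Dhe rhe] := hr e Ee.
pose f1 i := if i == h e then e else f i.
have neqf i : i \in D -> f i != e.
  by move=> Di; apply: contraNneq fDe => <-; apply: imset_f.
apply: (IHn f1) => [i j Di Dj | i Di | ].
- rewrite /f1; case: eqP => [-> | _]; case: eqP => [-> | _] //.
  + by move/esym/eqP; rewrite (negPf (neqf _ _)).
  + by move/eqP; rewrite (negPf (neqf _ _)).
  exact: f_inj.
- by rewrite /f1; case: eqP => [-> | _]; [ | apply: fr].
apply: leq_trans (_ : #|[set e in E | f (h e) != e]| <= _) => //.
apply: proper_card; apply/properP; split; last first.
  by exists e; rewrite !inE Ee ?neqf // /f1 !eqxx.
apply/subsetP=> e'; rewrite !inE => /andP[Ee']; rewrite Ee' /f1 /=.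
have [/h_inj eq_ee _ | //] := eqVneq (h e') (h e).
by rewrite eq_ee // neqf // (hr _ Ee).1.
Qed.

End Hall.

(** * Matchings as involutions *)

Section Coverable.
Import mathcomp.boot.fintype mathcomp.boot.finset.
Local Open Scope nat_scope.

Variables (V : finType) (g : rel V).
Hypotheses (g_sym : ssrbool.symmetric g) (g_irr : irreflexive g).
Implicit Types (m : V -> V) (A B C W X : {set V}).

(** A matching is encoded as the involution that exchanges the two ends of each
    edge and fixes the uncovered vertices: matchings on disjoint sets are then
    glued pointwise, and parity arguments concern orbits of an involution. *)
Definition matching_in W m :=
  involutive m /\ forall x, m x != x -> g x (m x) && (x \in W).

Definition coverable W X :=
  exists2 m, matching_in W m & {in X, forall x, m x != x}.

Lemma coverableW W W' X X' :
  W \subset W' -> X' \subset X -> coverable W X -> coverable W' X'.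
Proof.
move=> sWW' sX'X [m [mK mg] mX]; exists m; last by move=> x /(subsetP sX'X)/mX.
by split=> // x /mg/andP[-> /(subsetP sWW')].
Qed.

(** The edges used in one fibre of [key] stay inside it, so the matchings chosen
    in the fibres do not interfere. *)
Lemma coverable_glue (L : Type) (key : V -> L) W X :
    (forall k, coverable [set x in W | `[< key x = k >]]
                         [set x in X | `[< key x = k >]]) ->
  coverable W X.
Proof.
move=> cov; have /choice[M MP] k : exists m,
    matching_in [set x in W | `[< key x = k >]] m
    /\ {in [set x in X | `[< key x = k >]], forall x, m x != x}.
  by have [m] := cov k; exists m.
have keyM k x : M k x != x -> [/\ g x (M k x), x \in W & key x = k].
  by case: (MP k) => [[_ Mg] _] /Mg; rewrite inE => /and3P[-> -> /asboolP].
have MK k : involutive (M k) by case: (MP k) => [[]].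
exists (fun x => M (key x) x) => [|x Xx]; last first.
  by case: (MP (key x)) => _; apply; rewrite inE Xx; apply/asboolP.
split=> x; last by case/keyM=> -> ->.
have [eqMx | Mx] := eqVneq (M (key x) x) x; first by rewrite !eqMx.
have [|_ _ ->] := @keyM (key x) (M (key x) x); last exact: MK.
by rewrite MK eq_sym.
Qed.

Lemma coverable_edge x y : g x y -> coverable [set x; y] [set x; y].
Proof.
move=> gxy; have nxy : x != y by apply: contraTneq gxy => ->; rewrite g_irr.
pose m z := if z == x then y else if z == y then x else z.
have mx : m x = y by rewrite /m eqxx.
have my : m y = x by rewrite /m eqxx [y == x]eq_sym (negPf nxy).
exists m => [|z /set2P[]->]; rewrite ?mx ?my //; last by rewrite eq_sym.
split=> z; rewrite 1?[m z]/m.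
  have [-> // | nzx] := eqVneq z x; have [-> // | nzy] := eqVneq z y.
  by rewrite /m (negPf nzx) (negPf nzy).
rewrite !inE; have [-> | nzx] := eqVneq z x; first by rewrite gxy.
by have [-> | nzy] := eqVneq z y; rewrite ?eqxx // g_sym gxy.
Qed.

(** This is the parity fact behind the Tutte-Berge bound: an odd set covered by a
    matching has an edge leaving it. *)
Lemma even_fixfree m C : involutive m ->
  {in C, forall x, m x != x} -> {in C, forall x, m x \in C} -> ~~ odd #|C|.
Proof.
move=> mK; have [n] := ubnP #|C|; elim: n C => // n IHn C leCn m_ne mC.
have [-> | [x Cx]] := set_0Vmem C; first by rewrite cards0.
have Cmx : m x \in C :\ x by rewrite !inE m_ne ?mC.
have eqC : #|C| = #|C :\ x :\ m x|.+2.
  by rewrite (cardsD1 x) Cx (cardsD1 (m x)) Cmx.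
rewrite eqC /= negbK; apply: IHn.
- by rewrite -ltnS; apply: leq_trans leCn; rewrite eqC.
- by move=> y /setD1P[_ /setD1P[_ /m_ne]].
move=> y /setD1P[nymx /setD1P[nyx Cy]]; rewrite !inE mC // andbT.
by rewrite (can_eq mK) nyx; apply: contra nymx => /eqP <-; rewrite mK.
Qed.

Lemma match_indepP A B :
  reflect (B \subset A /\ coverable setT B) (B \in match_indep g A).
Proof.
rewrite inE; apply: (iffP andP) => -[sBA].
  case/existsP=> M /andP[/andP[sME tiM] sBM]; split=> //.
  have inM e : e \in M -> exists2 p, g p.1 p.2 & e = [set p.1; p.2].
    move/(subsetP sME); rewrite inE => /existsP[x /existsP[y /andP[gxy /eqP]]].
    by exists (x, y).
  pose m x := odflt x [pick y | (y != x) && ([set x; y] \in M)].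
  have mP x y : y != x -> [set x; y] \in M -> m x = y.
    move=> nyx Mxy; rewrite /m; case: pickP => [z /andP[nzx Mxz] | /(_ y)] /=.
      have eq_e: [set x; y] = [set x; z].
        by rewrite -(def_pblock tiM Mxy (set21 x y)) (def_pblock tiM Mxz (set21 x z)).
      have: z \in [set x; y] by rewrite eq_e set22.
      by case/set2P=> // eq_zx; rewrite eq_zx eqxx in nzx.
    by rewrite nyx Mxy.
  have mV x : m x != x -> (m x != x) && ([set x; m x] \in M).
    rewrite {1 3}/m; case: pickP => [z /andP[nzx Mxz] /= | ] ; last by rewrite eqxx.
    by rewrite (mP x z) // nzx.
  exists m => [|x /(subsetP sBM)/bigcupP[e Me]].
    split=> x.
      have [eqmx | /mV/andP[nmx Mx]] := eqVneq (m x) x; first by rewrite !eqmx.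
      by apply: mP; [rewrite eq_sym | rewrite setUC].
    case/mV/andP=> nmx /inM[[y z] /= gyz eq_e]; rewrite inE andbT.
    have: x \in [set y; z] by rewrite -eq_e set21.
    have: m x \in [set y; z] by rewrite -eq_e set22.
    by case/set2P=> eqmx /set2P[]eqx; rewrite eqmx eqx ?eqxx // in nmx *;
       rewrite g_sym.
  have [[y z] /= gyz def_e] := inM e Me.
  have nyz : y != z by apply: contraTneq gyz => ->; rewrite g_irr.
  rewrite def_e in Me * => /set2P[]->; last by rewrite (mP z y) // setUC.
  by rewrite (mP y z) // eq_sym.
case=> m [mK mg] mB; split=> //.
pose M := [set [set x; m x] | x in [set x | m x != x]].
apply/existsP; exists M; rewrite /matching -andbA; apply/and3P; split.
- apply/subsetP=> e /imsetP[x]; rewrite inE => /mg/andP[gx _] ->.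
  by rewrite inE; apply/existsP; exists x; apply/existsP; exists (m x); rewrite gx /=.
- apply/trivIsetP=> e1 e2 /imsetP[x _ ->] /imsetP[y _ ->]; apply: contraNT.
  case/pred0Pn=> z /= /andP[/set2P[]-> /set2P[]]; first by move=> ->.
  + by move=> ->; rewrite mK setUC.
  + by move=> <-; rewrite mK setUC.
  by move/(inv_inj mK)->.
apply/subsetP=> x Bx; apply/bigcupP; exists [set x; m x]; last exact: set21.
by apply: imset_f; rewrite inE mB.
Qed.

End Coverable.

(** * Barriers *)

Section Barriers.
Import mathcomp.boot.fintype mathcomp.boot.finset.
Local Open Scope nat_scope.

Variables (V : finType) (g : rel V).
Hypotheses (g_sym : ssrbool.symmetric g) (g_irr : irreflexive g).
Variable A : {set V}.
Implicit Types (B C D W X U : {set V}) (P : {set {set V}}) (f : V -> {set V}).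
Local Notation coverable := (coverable g).

Definition adjacent u C := [exists v in C, g u v].

(** Removing U from W leaves the blocks of P, with no edge between two of them.
    The blocks are unions of connected components, and need not be connected:
    this lets them be merged.  The alternative x == y in the last condition
    makes the blocks disjoint. *)
Definition barrier W U P :=
  [/\ U \subset W,
      {in P, forall C, C != set0 /\ C \subset W :\: U},
      W :\: U \subset finset.cover P
    & {in P &, forall C D x y, x \in C -> y \in D -> (x == y) || g x y -> C = D}].

Definition inner P := [set C in P | C \subset A].

(** This is the structure of Gallai and Edmonds, relative to A: factor-critical
    blocks inside A, other blocks covered as far as A is concerned, and U
    matched into the blocks inside A by f. *)
Definition critical W U P f :=
  [/\ barrier W U P,
      {in inner P, forall C, odd #|C| /\ {in C, forall c, coverable (C :\ c) (C :\ c)}},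
      {in P, forall C, ~~ (C \subset A) -> coverable C (C :&: A)},
      {in U &, injective f}
    & {in U, forall u, f u \in inner P /\ adjacent u (f u)}].

Lemma barrier_trivIset W U P : barrier W U P -> finset.trivIset P.
Proof.
case=> _ _ _ sep; apply/trivIsetP=> C D PC PD; apply: contraNT => /pred0Pn[x].
by case/andP=> /= Cx Dx; rewrite (sep C D PC PD x x) ?eqxx.
Qed.

Lemma barrier_partition W U P : barrier W U P -> partition P (W :\: U).
Proof.
move=> barP; have [sUW blk sWP _] := barP; apply/and3P; split.
- rewrite eqEsubset sWP andbT; apply/bigcupsP=> C /blk[] //.
- exact: barrier_trivIset barP.
by apply/negP=> /blk[]; rewrite eqxx.
Qed.

(** A block f u is covered together with u, by an edge from u to a vertex v of the
    block and a perfect matching of the rest.  In any other block inside A, a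
    vertex outside X is left uncovered. *)
Lemma critical_cover W U P f X : critical W U P f -> X \subset W :&: A ->
    {in inner P, forall C, C \notin f @: U -> ~~ (C \subset X)} ->
  coverable W X.
Proof.
case=> barP inner_cov outer_cov f_inj fP /subsetIP[sXW sXA] missed.
have [sUW blk sWP sep] := barP; have tiP := barrier_trivIset barP.
have blkW C x : C \in P -> x \in C -> (x \in W) && (x \notin U).
  by move=> PC Cx; have [_ /subsetP/(_ x Cx)] := blk C PC; rewrite inE andbC.
have Wblk x : x \in W -> x \notin U -> pblock P x \in P /\ x \in pblock P x.
  by move=> Wx nUx; rewrite pblock_mem ?mem_pblock (subsetP sWP) // inE Wx nUx.
pose key x := if x \in U then f x else pblock P x.
have keyB C x : C \in P -> x \in C -> key x = C.
  by move=> PC Cx; rewrite /key; case/andP: (blkW C x PC Cx) => _ /negPf->;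
     apply: def_pblock.
have keyP x : x \in W -> key x \in P.
  move=> Wx; rewrite /key; case: ifPn => [/fP[] | /Wblk[]//].
  by rewrite inE => /andP[].
apply: (@coverable_glue _ g _ key) => C.
(* A label that is not a block has an empty fibre. *)
have [PC | nPC] := boolP (C \in P); last first.
  have -> : [set x in X | `[< key x = C >]] = set0.
    apply/setP=> x; rewrite !inE; apply/andP=> -[/(subsetP sXW) Wx /asboolP eqC].
    by rewrite -eqC keyP in nPC.
  exists id => [|x]; last by rewrite inE.
  by split=> // x; rewrite eqxx.
have [/imsetP[u Uu eqC] | nfC] := boolP (C \in f @: U).
  have [_ /exists_inP[v fv guv]] := fP u Uu; rewrite -eqC in fv.
  have innC : C \in inner P by rewrite eqC; have [] := fP u Uu.
  have [_ /(_ v fv) cov_Cv] := inner_cov C innC.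
  apply: (@coverableW _ _ (u |: C) _ (u |: C)).
  - apply/subsetP=> x; rewrite !inE => /predU1P[-> | Cx].
      by rewrite (subsetP sUW) //; apply/asboolP; rewrite /key Uu.
    by have /andP[-> _] := blkW C x PC Cx; apply/asboolP; apply: keyB.
  - apply/subsetP=> x; rewrite !inE => /andP[/(subsetP sXW) Wx /asboolP].
    rewrite /key; case: ifPn => [Ux | /(Wblk x Wx)[_ xP <-]]; last by rewrite xP orbT.
    by rewrite eqC => /f_inj->; rewrite ?eqxx.
  pose in_edge x := x \in [set u; v].
  have nCu : u \notin C by apply: contraL Uu => /(blkW C u PC)/andP[].
  apply: (@coverable_glue _ g _ in_edge) => -[].
    apply: coverableW (coverable_edge g_sym g_irr guv); apply/subsetP=> x.
      move=> xuv; rewrite inE; apply/andP; split; last exact/asboolP.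
      by move: xuv; rewrite !inE => /pred2P[]->; rewrite ?eqxx ?fv ?orbT.
    by rewrite inE => /andP[_ /asboolP].
  apply: coverableW cov_Cv; apply/subsetP=> x; rewrite !inE.
    move=> /andP[nxv Cx]; rewrite Cx orbT; apply/asboolP.
    rewrite /in_edge !inE (negPf nxv) orbF; apply: contraTF Cx => /eqP-> //.
  by case/andP=> /predU1P[->|->] /asboolP; rewrite /in_edge !inE ?eqxx // => /norP[_ ->].
have sCW : C \subset [set x in W | `[< key x = C >]].
  apply/subsetP=> x Cx; rewrite inE; have /andP[-> _] := blkW C x PC Cx.
  by apply/asboolP; apply: keyB.
have sXC : [set x in X | `[< key x = C >]] \subset C :&: X.
  apply/subsetP=> x; rewrite !inE => /andP[Xx /asboolP]; rewrite Xx andbT.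
  have Wx := subsetP sXW x Xx.
  rewrite /key; case: ifPn => [Ux eqC | nUx <-]; last by have [] := Wblk x Wx nUx.
  by rewrite -eqC imset_f in nfC.
have [sCA | nCA] := boolP (C \subset A); last first.
  apply: coverableW sCW _ (outer_cov C PC nCA).
  by apply: subset_trans sXC _; apply: setIS.
have innC : C \in inner P by rewrite inE PC.
have /subsetPn[c Cc nXc] := missed C innC nfC.
have [_ /(_ c Cc)] := inner_cov C innC; apply: coverableW.
  by apply: subset_trans (subD1set _ _) sCW.
apply: subset_trans sXC _; apply/subsetP=> x /setIP[Cx Xx]; rewrite !inE Cx andbT.
by apply: contraNneq nXc => <-.
Qed.

(** A barrier inside a block, with one vertex of the block removed, refines the
    barrier. *)
Lemma barrier_refine W U P C c U' P' :
    barrier W U P -> C \in P -> c \in C -> barrier (C :\ c) U' P' ->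
  barrier W (c |: (U :|: U')) ((P :\ C) :|: P').
Proof.
move=> [sUW blk sWP sep] PC Cc [sUC' blk' sCP' sep'].
have [_ sCWU] := blk C PC.
have CWU x : x \in C -> (x \in W) && (x \notin U).
  by move/(subsetP sCWU); rewrite inE andbC.
have blkC' D x : D \in P' -> x \in D -> [/\ x \notin U', x != c & x \in C].
  move=> P'D Dx; have [_ /subsetP/(_ x Dx)] := blk' D P'D.
  by rewrite !inE => /and3P[].
split.
- rewrite subUset sub1set; case/andP: (CWU c Cc) => -> _.
  rewrite subUset sUW /=; apply: subset_trans sUC' _; apply/subsetP=> x.
  by case/setD1P=> _ /CWU/andP[].
- move=> D /setUP[/setD1P[nDC PD] | P'D]; last first.
    have [-> _] := blk' D P'D; split=> //; apply/subsetP=> x Dx.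
    have [nU'x nxc Cx] := blkC' D x P'D Dx; have /andP[Wx nUx] := CWU x Cx.
    by rewrite !inE negb_or nxc negb_or nUx nU'x.
  have [-> sDWU] := blk D PD; split=> //; apply/subsetP=> x Dx.
  have := subsetP sDWU x Dx; rewrite !inE !negb_or => /andP[-> ->].
  have nCx : x \notin C.
    by apply: contra nDC => Cx; rewrite (sep D C PD PC x x) ?eqxx.
  rewrite andbT; apply/andP; split; first by apply: contraNneq nCx => ->.
  by apply: contra nCx => /(subsetP sUC')/setD1P[].
- apply/subsetP=> x; rewrite !inE !negb_or -!andbA => /and4P[nxc nUx nU'x Wx].
  have /bigcupP[D PD Dx] : x \in finset.cover P by rewrite (subsetP sWP) // inE nUx.
  have [eqDC | neqDC] := eqVneq D C; last first.
    by apply/bigcupP; exists D; rewrite // !inE neqDC PD.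
  have /bigcupP[E P'E Ex] : x \in finset.cover P'.
    by rewrite (subsetP sCP') // !inE nU'x nxc -eqDC.
  by apply/bigcupP; exists E; rewrite // inE P'E orbT.
move=> D E PD PE x y Dx Ey xy; have yx : (y == x) || g y x by rewrite eq_sym g_sym.
case/setUP: PD => [/setD1P[nDC PD] | P'D]; case/setUP: PE => [/setD1P[nEC PE] | P'E].
- exact: (sep D E PD PE x y).
- have [_ _ Cy] := blkC' E y P'E Ey.
  by rewrite (sep D C PD PC x y) ?eqxx in nDC.
- have [_ _ Cx] := blkC' D x P'D Dx.
  by rewrite (sep E C PE PC y x) ?eqxx in nEC.
exact: (sep' D E P'D P'E x y).
Qed.

(** Vertices of U can be given back, at the cost of merging them with all the
    blocks that they are adjacent to. *)
Lemma barrier_merge W U P (S : {set V})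
    (N : {set {set V}} := [set C in P | [exists u in S, adjacent u C]]) :
    barrier W U P -> S \subset U -> S != set0 ->
  barrier W (U :\: S) ((S :|: finset.cover N) |: (P :\: N)).
Proof.
move=> [sUW blk sWP sep] sSU Sn0; set B := _ :|: finset.cover N.
have blkU C x : C \in P -> x \in C -> x \notin U.
  by move=> PC Cx; have [_ /subsetP/(_ x Cx)] := blk C PC; rewrite inE => /andP[].
have noB C x y : C \in P :\: N -> x \in B -> y \in C -> (x == y) || g x y -> False.
  case/setDP=> PC nNC Bx Cy xy; case/setUP: Bx => [Sx | /bigcupP[D ND Dx]].
    case/predU1P: xy => [eqxy | gxy].
      by have := blkU C y PC Cy; rewrite -eqxy (subsetP sSU).
    case/negP: nNC; rewrite inE PC; apply/exists_inP; exists x => //.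
    by apply/exists_inP; exists y.
  have PD : D \in P by move: ND; rewrite inE => /andP[].
  by rewrite (sep D C PD PC x y) in ND; rewrite // ND in nNC.
split.
- by apply: subset_trans sUW; apply: subsetDl.
- move=> C /setU1P[-> | /setDP[PC _]].
    split; first by apply: contraNneq Sn0 => B0; rewrite -subset0 -B0 subsetUl.
    rewrite subUset; apply/andP; split.
      by apply/subsetP=> x Sx; rewrite !inE Sx (subsetP sUW) ?(subsetP sSU).
    apply/bigcupsP=> D; rewrite inE => /andP[PD _]; have [_ sC] := blk D PD.
    by apply: subset_trans sC _; apply: setDS; apply: subsetDl.
  have [-> sC] := blk C PC; split=> //.
  by apply: subset_trans sC _; apply: setDS; apply: subsetDl.
- apply/subsetP=> x /setDP[Wx]; rewrite inE negb_and negbK.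
  case: (boolP (x \in S)) => [Sx _ | nSx /= nUx].
    by apply/bigcupP; exists B; rewrite ?setU11 // inE Sx.
  have /bigcupP[C PC Cx] : x \in finset.cover P by rewrite (subsetP sWP) // inE nUx.
  have [NC | nNC] := boolP (C \in N); apply/bigcupP; last first.
    by exists C; rewrite // !inE PC andbT; move: nNC; rewrite inE PC => ->; rewrite orbT.
  by exists B; rewrite ?setU11 // inE (negPf nSx); apply/bigcupP; exists C.
move=> C D /setU1P PC /setU1P PD x y Cx Dy xy.
have yx : (y == x) || g y x by rewrite eq_sym g_sym.
case: PC PD => [eqC | PC] [eqD | PD].
- by rewrite eqC.
- by case: (noB D x y); rewrite -?eqC.
- by case: (noB C y x); rewrite -?eqD.
by case/setDP: PC PD => PC _ /setDP[PD _]; apply: (sep C D PC PD x y).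
Qed.

Definition odd_inner P := [set C in inner P | odd #|C|].

(** The barrier maximises [#|odd_inner P| - #|U|], and then [#|U|]; the
    differences are rearranged to avoid truncated subtraction. *)
Definition optimal W U P := barrier W U P /\ forall U' P', barrier W U' P' ->
  #|odd_inner P'| + #|U| <= #|odd_inner P| + #|U'| /\
  (#|odd_inner P| + #|U'| <= #|odd_inner P'| + #|U| -> #|U'| <= #|U|).

Lemma optimal_barrier W : exists U P, optimal W U P.
Proof.
(* As #|U| <= #|V|, the weight #|V|.+1 makes this a lexicographic order; adding
   #|V| keeps the difference nonnegative. *)
pose score (s : {set V} * {set {set V}}) :=
  (#|odd_inner s.2| + #|V| - #|s.1|) * #|V|.+1 + #|s.1|.
have barW : `[< barrier W W set0 >].
  by apply/asboolP; split; rewrite ?setDv ?sub0set // => C; rewrite inE.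
have [[U P] /= /asboolP barP maxP] :=
  @arg_maxnP _ (W, set0) (fun s => `[< barrier W s.1 s.2 >]) score barW.
exists U, P; split=> // U' P' barP'.
have := maxP (U', P') (asboolT barP'); rewrite /score /=.
have := max_card U; have := max_card U'.
move: #|U| #|U'| #|V| #|odd_inner P| #|odd_inner P'| => u u' v q q' le1 le2 le3.
have le4 : q' + v - u' <= q + v - u.
  rewrite leqNgt; apply/negP=> lt; have := leq_mul lt (leqnn v.+1); lia.
split=> [|le5]; first by lia.
have eq6 : q' + v - u' = q + v - u by lia.
by rewrite eq6 leq_add2l in le3.
Qed.

End Barriers.

(** * The critical barrier *)

Section CriticalBarrier.
Import mathcomp.boot.fintype mathcomp.boot.finset.
Local Open Scope nat_scope.

Variables (V : finType) (g : rel V).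
Hypotheses (g_sym : ssrbool.symmetric g) (g_irr : irreflexive g).
Variable A : {set V}.
Implicit Types (B C D W X U : {set V}) (P : {set {set V}}) (f : V -> {set V}).

(** If fewer than |S| blocks inside A are adjacent to a subset S of U, then merging
    S with its neighbours loses fewer than |S| odd blocks and removes |S| vertices
    from U, which contradicts optimality. *)
Lemma optimal_matchable W U P : optimal g A W U P ->
  exists f : V -> {set V}, {in U &, injective f}
    /\ {in U, forall u, f u \in inner A P /\ adjacent g u (f u)}.
Proof.
move=> [barP opt].
have [|f [f_inj fP]] := @hall_marriage _ _ set0 U
    (fun u => [set C in inner A P | adjacent g u C]); last first.
  by exists f; split=> // u /fP; rewrite inE => /andP.
move=> S sSU; set N := \bigcup_(_ in _) _; rewrite leqNgt; apply/negP=> ltNS.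
have Sn0 : S != set0 by apply: contraTneq ltNS => ->; rewrite cards0.
have [leq_q _] := opt _ _ (barrier_merge g_sym barP sSU Sn0).
move: leq_q; set N' := [set C in P | _]; set P1 := _ |: _.
have sqP1 : odd_inner A P :\: N \subset odd_inner A P1.
  apply/subsetP=> C /setDP[]; rewrite !inE => /andP[/andP[PC sCA] oddC] nNC.
  rewrite sCA oddC PC !andbT /=; apply/orP; right; apply: contra nNC.
  case/exists_inP=> u Su uC; apply/bigcupP; exists u => //.
  by rewrite !inE PC sCA.
have := subset_leq_card sqP1; rewrite cardsD cardsDS //.
have := subset_leq_card (subsetIr (odd_inner A P) N).
have := subset_leq_card sSU; move: ltNS.
by move: #|S| #|U| #|N| #|odd_inner A P| #|odd_inner A P1| #|_ :&: _|; lia.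
Qed.

(** Inside A every block is odd. *)
Lemma critical_parity W U P f : critical g A W U P f -> W \subset A ->
  odd #|W| = odd (#|U| + #|inner A P|).
Proof.
case=> barP inn _ _ _ sWA; have [sUW blk _ _] := barP.
have innP : inner A P = P.
  apply/setP=> C; rewrite inE andb_idr // => /blk[_ sC].
  by apply: subset_trans sC _; apply: subset_trans (subsetDl _ _) sWA.
have := cardsDS sUW; have := subset_leq_card sUW.
rewrite (card_partition (barrier_partition barP)) => leUW eq_sum.
have -> : #|W| = #|U| + \sum_(C in P) #|C| by rewrite eq_sum subnKC.
rewrite !oddD innP; congr addb; rewrite -sum1_card.
rewrite !(big_morph odd oddD (erefl : odd 0 = false)); apply: eq_bigr => C PC.
by rewrite -innP in PC; have [->] := inn C PC.
Qed.

Lemma critical_inner_odd W U P f :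
  critical g A W U P f -> odd_inner A P = inner A P.
Proof.
by case=> _ inn _ _ _; apply/setP=> C; rewrite inE andb_idr // => /inn[].
Qed.

Lemma critical_leq W U P f : critical g A W U P f -> #|U| <= #|inner A P|.
Proof.
case=> _ _ _ f_inj fP; rewrite -(card_in_imset f_inj) subset_leq_card //.
by apply/subsetP=> _ /imsetP[u Uu ->]; have [] := fP u Uu.
Qed.

(** When U and the blocks inside A are equally many, every such block is reached
    by f, so that no vertex of A needs to be left uncovered. *)
Lemma critical_full W U P f : critical g A W U P f ->
  #|U| = #|inner A P| -> coverable g W (W :&: A).
Proof.
move=> crit eqUP; apply: (critical_cover g_sym g_irr crit) => // C innC.
have [_ _ _ f_inj fP] := crit.
suff -> : f @: U = inner A P by rewrite innC.
apply/eqP; rewrite eqEcard card_in_imset // eqUP leqnn andbT.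
by apply/subsetP=> _ /imsetP[u Uu ->]; have [] := fP u Uu.
Qed.

(** The optimal barrier is critical.  For a vertex c of a block C, take by
    induction a critical barrier U', P' of C minus c.  Adding c and U' to U and
    replacing C by P' enlarges U, so optimality bounds the number of blocks of P'
    inside A by |U'|, or by |U'| + 1 if C itself is odd and inside A.  In the first
    case C minus c is covered as far as A is concerned: this settles the blocks
    not inside A, by taking c outside A.  For blocks inside A, parity excludes
    even C and excludes |U'| + 1 for odd C. *)
Lemma critical_barrier W : exists U P f, critical g A W U P f.
Proof.
have [n] := ubnP #|W|; elim: n W => // n IHn W leWn.
have [U [P optP]] := optimal_barrier g A W.
have [f [f_inj fP]] := optimal_matchable optP; exists U, P, f.
have [barP opt] := optP.
have [sUW blk _ sep] := barP.
have sub_crit C c : C \in P -> c \in C -> exists U' P' f',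
    critical g A (C :\ c) U' P' f'
    /\ #|inner A P'| <= #|U'| + (C \in odd_inner A P).
  move=> PC Cc.
  have [|U' [P' [f' crit]]] := IHn (C :\ c).
    rewrite -ltnS; apply: leq_trans leWn; rewrite ltnS.
    have [_ sC] := blk C PC; have := subset_leq_card sC.
    have := subset_leq_card (subsetDl W U); rewrite (cardsD1 c C) Cc; lia.
  exists U', P', f'; split=> //.
  have [barP' _ _ _ _] := crit; have [sUC blk' _ _] := barP'.
  have [_ ] := opt _ _ (barrier_refine g_sym barP PC Cc barP').
  have sCWU : {subset C <= W :\: U} by have [_ /subsetP] := blk C PC.
  have -> : #|c |: (U :|: U')| = (#|U| + #|U'|).+1.
    rewrite cardsU1 cardsU !inE negb_or.
    have -> : U :&: U' = set0.
      apply/setP=> x; rewrite !inE; apply/andP=> -[Ux /(subsetP sUC)/setD1P[_]].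
      by move/sCWU; rewrite inE Ux.
    have -> : c \notin U' by apply/negP=> /(subsetP sUC); rewrite !inE eqxx.
    by have := sCWU c Cc; rewrite inE cards0 => /andP[-> _] /=; rewrite subn0.
  have -> : odd_inner A (P :\ C :|: P') = (odd_inner A P :\ C) :|: odd_inner A P'.
    by apply/setP=> D; rewrite !inE; do !case: (_ \in _); do !case: (_ == _);
       rewrite ?andbT ?andbF ?orbF ?orbT //= ?orbb.
  rewrite cardsU (critical_inner_odd crit).
  have -> : (odd_inner A P :\ C) :&: inner A P' = set0.
    apply/setP=> D; rewrite !inE; apply/negP.
    case/andP=> /andP[nDC /andP[/andP[PD _] _]] /andP[P'D _].
    have [Dn0 sD] := blk' D P'D; have /set0Pn[x Dx] := Dn0.
    have := subsetP sD x Dx; rewrite !inE => /and3P[_ _ Cx].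
    by rewrite (sep D C PD PC x x) ?eqxx in nDC.
  rewrite cards0 subn0 (cardsD1 C (odd_inner A P)).
  have := critical_leq crit.
  move: #|U| #|U'| #|_ :\ _| #|inner A P'| (_ \in _) => u u' q q' b.
  lia.
have inner_odd C : C \in inner A P -> odd #|C| /\
    {in C, forall c, coverable g (C :\ c) (C :\ c)}.
  move=> innC; have [PC sCA] : C \in P /\ C \subset A by apply/andP; rewrite inE in innC.
  have parity c U' P' f' : c \in C -> critical g A (C :\ c) U' P' f' ->
      odd #|C| = ~~ odd (#|U'| + #|inner A P'|).
    move=> Cc crit; rewrite -(critical_parity crit); last first.
      by apply: subset_trans (subD1set _ _) sCA.
    by rewrite (cardsD1 c C) Cc.
  have oddC : odd #|C|.
    have [/set0Pn[c Cc] _] := blk C PC.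
    have [U' [P' [f' [crit]]]] := sub_crit C c PC Cc.
    rewrite inE innC; case oddC: (odd #|C|) => //=; rewrite addn0 => leP'.
    have eqUP: #|U'| = #|inner A P'|.
      by apply/eqP; rewrite eqn_leq (critical_leq crit).
    by have := parity c U' P' f' Cc crit; rewrite oddC eqUP oddD addbb.
  split=> // c Cc; have [U' [P' [f' [crit]]]] := sub_crit C c PC Cc.
  rewrite inE innC oddC /= => leP'.
  have := parity c U' P' f' Cc crit; rewrite oddC => /esym/negbTE par.
  apply: coverableW (critical_full crit _) => //.
    by rewrite subsetI subxx; apply: subset_trans (subD1set _ _) sCA.
  have := critical_leq crit; move: par leP'.
  by move: #|U'| #|inner A P'| => u q; lia.
split=> // C PC nCA.
have /subsetPn[c Cc nAc] := nCA.
have [U' [P' [f' [crit]]]] := sub_crit C c PC Cc.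
rewrite !inE (negPf nCA) andbF addn0 => leP'.
apply: coverableW (critical_full crit _); first exact: subD1set.
  apply/subsetP=> x /setIP[Cx Ax]; rewrite !inE Cx Ax !andbT.
  by apply: contraNneq nAc => <-.
by apply/eqP; rewrite eqn_leq (critical_leq crit).
Qed.

End CriticalBarrier.

(** * Matching-matroids are transversal *)

Section Transversals.
Import mathcomp.boot.fintype mathcomp.boot.finset.
Local Open Scope nat_scope.

Definition full_transversal (J V : finType) (D : {set J}) (F : J -> {set V}) (B : {set V}) :=
  exists phi : J -> V,
    [/\ {in D &, injective phi}, {in D, forall j, phi j \in F j} & B = phi @: D].

Lemma card_transversal (J V : finType) (D : {set J}) (F : J -> {set V}) B :
  full_transversal D F B -> #|B| = #|D|.
Proof. by case=> phi [phi_inj _ ->]; apply: card_in_imset. Qed.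

(** As all transversals have the same cardinality, none of them is properly
    contained in another. *)
Lemma match_bases_transversal (V : finType) (g : rel V) A
    (J : finType) (D : {set J}) (F : J -> {set V}) :
    (forall B, full_transversal D F B -> B \in match_indep g A) ->
    (forall B, B \in match_indep g A -> exists2 T, full_transversal D F T & B \subset T) ->
  forall B, B \in match_bases g A <-> full_transversal D F B.
Proof.
move=> indT extT B; rewrite inE; split.
  case/maxsetP=> /extT[T trT sBT] maxB.
  by rewrite -(maxB T (indT T trT) sBT).
move=> trB; apply/maxsetP; split; first exact: indT.
move=> C /extT[T trT sCT] sBC; apply/eqP; rewrite eq_sym eqEcard sBC /=.
by rewrite (card_transversal trB) -(card_transversal trT) subset_leq_card.
Qed.

Variables (V : finType) (g : rel V).
Hypotheses (g_sym : ssrbool.symmetric g) (g_irr : irreflexive g).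
Variables (A U : {set V}) (P : {set {set V}}) (f : V -> {set V}).
Hypothesis crit : critical g A setT U P f.
Implicit Types (B C : {set V}).

Local Notation Q := (inner A P).

Definition block_rep (x : V) := odflt x [pick y in pblock Q x].

(** The |C| - 1 copies of a block C inside A are indexed by the vertices of C
    other than its representative. *)
Definition presentation_index : {set V + V} :=
  [set j | match j with
           | inl a => (a \in A) && ((a \in finset.cover Q) ==> (a != block_rep a))
           | inr u => u \in U
           end].

Definition presentation (j : V + V) : {set V} :=
  match j with
  | inl a => if a \in finset.cover Q then pblock Q a else [set a]
  | inr u => [set y in finset.cover Q | adjacent g u (pblock Q y)]
  end.

Local Notation D := presentation_index.
Local Notation F := presentation.

Let barP : barrier g setT U P. Proof. by case: crit. Qed.

Let innerP C : C \in Q -> C \in P /\ C \subset A.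
Proof. by rewrite inE => /andP. Qed.

Let trivQ : finset.trivIset Q.
Proof.
apply/trivIsetP=> C C' /innerP[PC _] /innerP[PC' _].
exact: (trivIsetP (barrier_trivIset barP)).
Qed.

Let blockE C x : C \in Q -> x \in C -> pblock Q x = C.
Proof. by move=> QC Cx; apply: def_pblock. Qed.

Let coverQ C x : C \in Q -> x \in C -> x \in finset.cover Q.
Proof. by move=> QC Cx; apply/bigcupP; exists C. Qed.

Let sub_coverQ x : x \in finset.cover Q -> x \in A.
Proof. by case/bigcupP=> C /innerP[_ /subsetP sCA] /sCA. Qed.

Let rep_in x : x \in finset.cover Q -> block_rep x \in pblock Q x.
Proof.
rewrite -mem_pblock /block_rep; case: pickP => [y // | /(_ x) /= ->] //.
Qed.

Let repE x y : x \in finset.cover Q -> y \in pblock Q x -> block_rep y = block_rep x.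
Proof.
move=> Qx xy; rewrite /block_rep (same_pblock trivQ xy).
by case: pickP => [// | /(_ y)]; rewrite /= xy.
Qed.

(** Besides the vertices indexed by the copies of C, a transversal contains those
    vertices of C that are chosen for elements of U. *)
Lemma presentation_block_card (phi : V + V -> V) C :
    {in D &, injective phi} -> {in D, forall j, phi j \in F j} -> C \in Q ->
  #|C :&: phi @: D| = #|C|.-1 + #|[set u in U | phi (inr u) \in C]|.
Proof.
move=> phi_inj phiF QC; set I_C := [set u in U | _].
have [c Cc] : exists c, c \in C.
  have [_ blk _ _] := barP; have [PC _] := innerP QC.
  by have [/set0Pn] := blk C PC.
pose r := block_rep c; have Qc := coverQ QC Cc.
have Cr : r \in C by have := rep_in Qc; rewrite (blockE QC Cc).
have eqr x : x \in C -> block_rep x = r.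
  by move=> Cx; apply: repE; rewrite // (blockE QC Cc).
pose K := [set j | match j with inl a => a \in C :\ r | inr u => u \in I_C end].
have sKD : K \subset D.
  apply/subsetP=> -[a | u]; rewrite !inE; last by case/andP.
  case/andP=> nar Ca; rewrite (eqr a Ca) nar implybT andbT.
  exact: sub_coverQ (coverQ QC Ca).
have -> : C :&: phi @: D = phi @: K.
  apply/setP=> x; rewrite inE; apply/andP/imsetP.
    case=> Cx /imsetP[j Dj eqx]; exists j => //.
    have := phiF j Dj; case: j Dj eqx => [a | u] /=; rewrite !inE; last first.
      by move=> -> <-; rewrite Cx.
    case/andP=> Aa; case: ifP => /= [Qa nra <- xa | Qa _ <- /set1P eqxa]; last first.
      by rewrite -eqxa (coverQ QC Cx) in Qa.
    have Ca : a \in C.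
      have : a \in pblock Q a by rewrite mem_pblock.
      by rewrite -(same_pblock trivQ xa) (blockE QC Cx).
    by rewrite Ca andbT -(eqr a Ca).
  case=> j Kj ->; have Dj := subsetP sKD j Kj; split; last exact: imset_f.
  have := phiF j Dj; case: j Kj Dj => [a | u] /=; rewrite !inE.
    by case/andP=> _ Ca _; rewrite (coverQ QC Ca) (blockE QC Ca).
  by case/andP.
rewrite card_in_imset; last by move=> x y /(subsetP sKD) Dx /(subsetP sKD); apply: phi_inj.
have -> : K = inl @: (C :\ r) :|: inr @: I_C.
  apply/setP=> -[a | u]; rewrite !inE.
    rewrite (mem_imset _ _ inl_inj) !inE orbC; case: imsetP => //; by case.
  rewrite (mem_imset _ _ inr_inj) !inE; case: imsetP => //; by case.
rewrite cardsU.
have -> : inl @: (C :\ r) :&: inr @: I_C = set0 :> {set V + V}.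
  by apply/setP=> j; rewrite !inE; apply/andP=> -[/imsetP[a _ ->] /imsetP[]].
rewrite cards0 subn0 !card_imset; [ | exact: inr_inj | exact: inl_inj].
by rewrite (cardsD1 r C) Cr.
Qed.

(** Counting in a block shows that at most one element of U chooses a vertex in
    it, and that a block chosen by none is not contained in the transversal.
    Hence U is matched into the blocks by its own choices, and
    [critical_cover] applies. *)
Lemma presentation_indep B : full_transversal D F B -> B \in match_indep g A.
Proof.
case=> phi [phi_inj phiF ->].
have phiU u : u \in U -> phi (inr u) \in finset.cover Q /\
    adjacent g u (pblock Q (phi (inr u))).
  move=> Uu; have Du : inr u \in D by rewrite inE.
  by have := phiF _ Du; rewrite inE => /andP.
have sBA : phi @: D \subset A.
  apply/subsetP=> _ /imsetP[j Dj ->]; have := phiF j Dj.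
  case: j Dj => [a | u]; rewrite /= !inE.
    case/andP=> Aa _; case: ifP => [Qa xa | _ /set1P->] //.
    by apply: sub_coverQ; rewrite -mem_pblock (same_pblock trivQ xa).
  by move=> _ /andP[/sub_coverQ].
apply/(match_indepP g_sym g_irr); split=> //.
pose f1 u := pblock Q (phi (inr u)).
have Qf1 u : u \in U -> f1 u \in Q by case/phiU=> Qu _; apply: pblock_mem.
have in_f1 u : u \in U -> phi (inr u) \in f1 u by case/phiU; rewrite mem_pblock.
have card_C C : C \in Q -> #|[set u in U | phi (inr u) \in C]| <= 1.
  move=> QC; have := presentation_block_card phi_inj phiF QC.
  have := subset_leq_card (subsetIl C (phi @: D)).
  have [_ blk _ _] := barP; have [PC _] := innerP QC; have [Cn0 _] := blk C PC.
  by rewrite -card_gt0 in Cn0; move: Cn0; move: #|C| #|_ :&: _| #|_|; lia.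
have f1_inj : {in U &, injective f1}.
  move=> u u' Uu Uu' eqf; have := card_C (f1 u) (Qf1 u Uu).
  move/card_le1_eqP; apply; rewrite inE ?Uu ?Uu' /= ?in_f1 //.
  by rewrite eqf in_f1.
have crit1 : critical g A setT U P f1.
  case: crit => ? ? ? _ _; split=> // u Uu; split; first exact: Qf1.
  by have [] := phiU u Uu.
apply: (critical_cover g_sym g_irr crit1); first by rewrite setTI.
move=> C QC nf1C; apply/negP=> sC.
have := presentation_block_card phi_inj phiF QC.
have -> : [set u in U | phi (inr u) \in C] = set0.
  apply/setP=> u; rewrite !inE; apply/andP=> -[Uu Cu].
  by case/imsetP: nf1C; exists u; rewrite // /f1 (blockE QC Cu).
have [_ blk _ _] := barP; have [PC _] := innerP QC; have [Cn0 _] := blk C PC.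
rewrite (setIidPl sC) cards0 addn0; rewrite -card_gt0 in Cn0.
by case: #|C| Cn0 => //= k _ /eqP; rewrite -[_ == _]negbK neq_ltn ltnSn orbT.
Qed.

(** A matching covering B leaves each block contained in B through U.  The
    resulting injection of these blocks into U is combined with f, giving an
    injection of U into the blocks inside A that reaches all the blocks contained
    in B; in every other block the transversal may omit a vertex outside B. *)
Lemma presentation_extend B : B \in match_indep g A ->
  exists2 T, full_transversal D F T & B \subset T.
Proof.
case/(match_indepP g_sym g_irr)=> sBA [m [mK mg] mB].
have [[_ blk sTP sep] Qcov _ f_inj fQ] := crit.
(* No edge joins two blocks, so an edge leaving a block ends in U. *)
have leave C : C \in Q -> C \subset B -> exists2 v, v \in C & m v \in U.
  move=> QC sCB; have [oddC _] := Qcov C QC; have [PC _] := innerP QC.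
  have [/exists_inP[v Cv nCmv] | ] := boolP [exists v in C, m v \notin C].
    exists v => //; have mv := mB v (subsetP sCB v Cv).
    apply: contraNT nCmv => nUmv.
    have /bigcupP[E PE Emv] : m v \in finset.cover P.
      by rewrite (subsetP sTP) // !inE nUmv.
    by have /andP[gv _] := mg v mv; rewrite (sep C E PC PE v (m v)) ?gv ?orbT.
  rewrite negb_exists_in => /forall_inP stabC.
  have := @even_fixfree V m C mK; rewrite oddC; case/(_ _ _)/negP => // v Cv.
    exact: mB (subsetP sCB v Cv).
  by have := stabC v Cv; rewrite negbK.
pose full := [set C in Q | C \subset B].
(* The default value x0 below needs a vertex. *)
have [V0 | [x0 _]] := set_0Vmem [set: V].
  have noV (x : V) : False by have := in_setT x; rewrite V0 inE.
  exists set0; last by apply/subsetP=> x; case: (noV x).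
  exists (fun j => match j with inl a | inr a => a end).
  by split=> [[a|a] | [a|a] |]; do ?case: (noV a); apply/setP=> x; case: (noV x).
pose v0 C := odflt x0 [pick v in C | m v \in U].
have v0P C : C \in full -> v0 C \in C /\ m (v0 C) \in U.
  rewrite inE => /andP[QC /(leave C QC)[v Cv Umv]]; rewrite /v0.
  by case: pickP => [w /andP[] // | /(_ v)]; rewrite Cv Umv.
have fullQ C : C \in full -> C \in Q by rewrite inE => /andP[].
have [f1 [f1_inj f1Q sfull]] : exists f1 : V -> {set V},
    [/\ {in U &, injective f1}, {in U, forall u, (f1 u \in Q) && adjacent g u (f1 u)}
      & full \subset f1 @: U].
  apply: (@mendelsohn_dulmage _ _ (fun u C => (C \in Q) && adjacent g u C)
            U full f (fun C => m (v0 C))) => //.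
  - by move=> u /fQ[-> ->].
  - move=> C C' fullC fullC' /(inv_inj mK) eqv.
    have [[Cv _] [C'v _]] := (v0P C fullC, v0P C' fullC').
    by rewrite -(blockE (fullQ C fullC) Cv) eqv (blockE (fullQ C' fullC')).
  move=> C fullC; have [Cv Umv] := v0P C fullC; split=> //; rewrite fullQ //=.
  apply/exists_inP; exists (v0 C) => //; rewrite g_sym.
  by have /mg/andP[] : m (v0 C) != v0 C by apply: mB; apply: (subsetP _ _ Cv);
     move: fullC; rewrite inE => /andP[].
(* The vertex that a block gives up: outside B when no u is matched to the block;
   otherwise the representative, which is then chosen for u. *)
pose hole x := odflt (block_rep x)
  [pick y in pblock Q x | (y \notin B) && (pblock Q x \notin f1 @: U)].
pose phi (j : V + V) : V := match j with
  | inl a => if a == hole a then block_rep a else a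
  | inr u => odflt u [pick y in f1 u]
  end.
have repU u y : u \in U -> y \in f1 u -> block_rep y = phi (inr u).
  case/f1Q/andP=> QC _ fy; rewrite /block_rep (blockE QC fy) /=.
  by case: pickP => // /(_ y); rewrite fy.
have phiU u : u \in U -> phi (inr u) \in f1 u.
  by case/f1Q/andP=> _ /exists_inP[v fv _] /=; case: pickP => // /(_ v); rewrite fv.
have hole_im x : pblock Q x \in f1 @: U -> hole x = block_rep x.
  by move=> im_x; rewrite /hole; case: pickP => // y; rewrite im_x !andbF.
have hole_in x : x \in finset.cover Q -> hole x \in pblock Q x.
  move=> Qx; rewrite /hole; case: pickP => [y /andP[] // | _]; exact: rep_in.
have holeE x y : x \in finset.cover Q -> y \in pblock Q x -> hole y = hole x.
  by move=> Qx xy; rewrite /hole -(same_pblock trivQ xy) (repE Qx xy).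
have hole_out x : x \notin finset.cover Q -> hole x = block_rep x /\ block_rep x = x.
  move=> nQx; rewrite /hole /block_rep; have -> : pblock Q x = set0.
    by rewrite /pblock; case: pickP => // C /andP[QC /(coverQ QC)]; rewrite (negPf nQx).
  by split; do 2?[case: pickP => [y /= | _]; rewrite ?inE //].
have hole_B x : x \in finset.cover Q -> hole x \in B -> pblock Q x \in f1 @: U.
  move=> Qx; apply: contraLR => nim; rewrite {1}/hole nim.
  case: pickP => [y /and3P[] // | all_B]; case/negP: (nim).
  apply: (subsetP sfull); rewrite inE pblock_mem //; apply/subsetP=> y xy.
  by have := all_B y; rewrite xy andbT /= => /negbFE.
have phi_blk a : a \in finset.cover Q -> phi (inl a) \in pblock Q a.
  by move=> Qa /=; case: eqP; rewrite ?mem_pblock // rep_in.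
have phi_cov a : a \in finset.cover Q -> phi (inl a) \in finset.cover Q.
  by move=> Qa; apply: coverQ (phi_blk a Qa); apply: pblock_mem.
have phi_out a : a \notin finset.cover Q -> phi (inl a) = a.
  by move=> Qa /=; have [-> ->] := hole_out a Qa; rewrite eqxx.
have blkU u : u \in U -> pblock Q (phi (inr u)) = f1 u.
  by move=> Uu; apply: blockE (phiU u Uu); have /andP[] := f1Q u Uu.
have covU u : u \in U -> phi (inr u) \in finset.cover Q.
  by move=> Uu; apply: coverQ (phiU u Uu); have /andP[] := f1Q u Uu.
have phi_lr a u : inl a \in D -> u \in U -> phi (inl a) != phi (inr u).
  rewrite inE => /andP[Aa nra] Uu.
  have [Qa | nQa] := boolP (a \in finset.cover Q); last first.
    by rewrite phi_out //; apply: contraNneq nQa => ->; apply: covU.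
  rewrite Qa /= in nra; apply/eqP=> eq_au.
  have blk_a : pblock Q a = f1 u.
    by rewrite -(blkU u Uu) -eq_au; apply/esym/same_pblock => //; apply: phi_blk.
  have fa : a \in f1 u by rewrite -blk_a mem_pblock.
  move: eq_au => /=; rewrite hole_im ?blk_a ?imset_f // (negPf nra).
  by move/eqP; rewrite -/(phi (inr u)) -(repU u a Uu fa) (negPf nra).
exists (phi @: D).
  exists phi; split=> //.
    move=> [a | u] [b | w] Dj Dk eq_phi.
    - congr inl; move: Dj Dk; rewrite !inE => /andP[_ nra] /andP[_ nrb].
      have [Qa | nQa] := boolP (a \in finset.cover Q); last first.
        have [Qb | nQb] := boolP (b \in finset.cover Q).
          by have := phi_cov b Qb; rewrite -eq_phi phi_out // (negPf nQa).
        by rewrite -(phi_out a nQa) eq_phi phi_out.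
      have ba : phi (inl b) \in pblock Q a by rewrite -eq_phi phi_blk.
      have [Qb | nQb] := boolP (b \in finset.cover Q); last first.
        by have := phi_cov a Qa; rewrite eq_phi phi_out // (negPf nQb).
      have ab : b \in pblock Q a.
        by rewrite -(same_pblock trivQ ba) (same_pblock trivQ (phi_blk b Qb)) mem_pblock.
      rewrite Qa Qb /= (repE Qa ab) in nra nrb.
      move: eq_phi => /=; rewrite (holeE a b Qa ab) (repE Qa ab).
      case: (eqVneq a (hole a)) => [eqa | _]; case: (eqVneq b (hole a)) => [eqb | _] //.
      + by move=> _; rewrite eqb.
      + by move=> eqb; rewrite -eqb eqxx in nrb.
      by move=> eqa; rewrite -eqa eqxx in nra.
    - by move: Dk; rewrite inE => /(phi_lr a w Dj); rewrite eq_phi eqxx.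
    - by move: Dj; rewrite inE => /(phi_lr b u Dk); rewrite eq_phi eqxx.
    move: Dj Dk; rewrite !inE => Uu Uw; congr inr; apply: f1_inj => //.
    by rewrite -(blkU u Uu) eq_phi blkU.
  move=> [a | u] Dj; rewrite [F _]/=.
    case: ifPn => [/phi_blk // | nQa]; by rewrite phi_out ?set11.
  have Uu : u \in U by move: Dj; rewrite inE.
  by rewrite inE covU // blkU //; have /andP[] := f1Q u Uu.
apply/subsetP=> b Bb; have Ab := subsetP sBA b Bb; apply/imsetP.
have [Qb | nQb] := boolP (b \in finset.cover Q); last first.
  by exists (inl b); rewrite ?inE ?Ab ?(negPf nQb) ?phi_out.
have [eqb | neqb] := eqVneq b (hole b).
  have im_b := hole_B b Qb; rewrite -eqb in im_b.
  have /imsetP[u Uu eqf] := im_b Bb.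
  exists (inr u); first by rewrite inE.
  by rewrite {1}eqb hole_im ?im_b // (repU u) // -eqf mem_pblock.
have [eqr | neqr] := eqVneq b (block_rep b).
  have hb := hole_in b Qb; exists (inl (hole b)).
    rewrite inE (sub_coverQ (x := hole b)) /=; last exact: coverQ (pblock_mem Qb) hb.
    by rewrite (repE Qb hb) -eqr [hole b == b]eq_sym neqb implybT.
  by rewrite /= (holeE b _ Qb hb) eqxx (repE Qb hb).
exists (inl b); first by rewrite inE Ab neqr implybT.
by rewrite /= (negPf neqb).
Qed.

End Transversals.

Section MatchingMatroids.
Import mathcomp.boot.fintype mathcomp.boot.finset.
Local Open Scope nat_scope.

(** The presentation above, indexed by an ordinal. *)
Theorem match_bases_presentation (V : finType) (g : rel V) (A : {set V}) :
    ssrbool.symmetric g -> irreflexive g ->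
  exists (t : nat) (F : 'I_t -> {set V}),
    forall B, B \in match_bases g A <-> full_transversal [set: 'I_t] F B.
Proof.
move=> g_sym g_irr; have [U [P [f crit]]] := critical_barrier g_sym g_irr A setT.
pose D := presentation_index A U P; pose F := presentation g A P.
exists #|D|, (fun i => F (enum_val i)) => B.
rewrite (match_bases_transversal (presentation_indep g_sym g_irr crit)
           (presentation_extend g_sym g_irr crit)) -/D -/F.
split=> -[phi [phi_inj phiF ->]].
  exists (fun i => phi (enum_val i)); split=> [i j _ _ eqij | i _ |].
  - exact: enum_val_inj (phi_inj _ _ (enum_valP i) (enum_valP j) eqij).
  - exact: phiF (enum_valP i).
  apply/setP=> x; apply/imsetP/imsetP=> -[j Dj ->].
    by exists (enum_rank_in Dj j); rewrite ?enum_rankK_in.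
  by exists (enum_val j); rewrite ?enum_valP.
have [D0 | [j0 Dj0]] := set_0Vmem D.
  have noD j : j \in D -> False by rewrite D0 inE.
  exists (fun j => match j with inl a | inr a => a end).
  split=> [i j | j |]; first by rewrite D0 inE.
    by rewrite D0 inE.
  apply/setP=> x; apply/imsetP/imsetP=> -[i Di]; last by rewrite D0 inE in Di.
  by case: (noD _ (enum_valP i)).
exists (fun j => phi (enum_rank_in Dj0 j)); split=> [i j Di Dj | j Dj |].
- move/phi_inj => /(_ (in_setT _) (in_setT _)) /(congr1 enum_val).
  by rewrite !enum_rankK_in.
- by have := phiF (enum_rank_in Dj0 j) (in_setT _); rewrite enum_rankK_in.
apply/setP=> x; apply/imsetP/imsetP=> -[i _ ->].
  by exists (enum_val i); rewrite ?enum_valP ?enum_valK_in.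
by exists (enum_rank_in Dj0 i); rewrite ?inE.
Qed.

Lemma match_bases_exist (V : finType) (g : rel V) (A : {set V}) :
  exists B, B \in match_bases g A.
Proof.
have ind0 : set0 \in match_indep g A.
  rewrite inE sub0set; apply/existsP; exists set0.
  rewrite /matching /Defs.meets !sub0set andbT.
  by apply/trivIsetP=> C D; rewrite inE.
have [B maxB _] := @maxset_exists _ (fun C => C \in match_indep g A) _ ind0.
by exists B; rewrite inE.
Qed.

(** An element of F j outside a transversal can be exchanged for the element chosen
    for j.  So as soon as a transversal exists, no element of the sets is a
    loop of the matroid. *)
Lemma transversal_through (J V : finType) (D : {set J}) (F : J -> {set V}) B j x :
    full_transversal D F B -> j \in D -> x \in F j ->
  exists2 T, full_transversal D F T & x \in T.
Proof.
case=> phi [phi_inj phiF eqB] Dj Fx; have [Bx | nBx] := boolP (x \in B).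
  by exists B => //; exists phi.
pose psi i := if i == j then x else phi i.
exists (psi @: D); last by apply/imsetP; exists j; rewrite // /psi eqxx.
have nx i : i \in D -> phi i != x.
  by move=> Di; apply: contraNneq nBx => <-; rewrite eqB imset_f.
exists psi; split=> // [i i' Di Di' | i Di]; rewrite /psi.
  case: eqP => [-> | _]; case: eqP => [-> | _] //; last exact: phi_inj.
    by move/esym/eqP; rewrite (negPf (nx _ Di')).
  by move/eqP; rewrite (negPf (nx _ Di)).
by case: eqP => [-> // | _]; apply: phiF.
Qed.

(** * Transversal matroids are matching-matroids *)

Lemma transversal_imset (J V W : finType) (h : V -> W) (F : J -> {set V}) B' :
    injective h ->
  full_transversal [set: J] (fun j => h @: F j) B' <->
  exists2 B, full_transversal [set: J] F B & B' = h @: B.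
Proof.
move=> h_inj; split=> [[phi [phi_inj phiF ->]] | [_ [phi [phi_inj phiF ->]] ->]].
  have /choice[psi psiP] j : exists x, x \in F j /\ phi j = h x.
    by have /imsetP[x] := phiF j (in_setT j); exists x.
  exists (psi @: setT); last first.
    by rewrite -imset_comp; apply: eq_imset => j /=; case: (psiP j).
  exists psi; split=> // [i j _ _ eqij | j _]; last by case: (psiP j).
  by apply: phi_inj => //; case: (psiP i) => _ ->; case: (psiP j) => _ ->; rewrite eqij.
exists (h \o phi); split=> [i j _ _ /h_inj | j _ |]; last by rewrite imset_comp.
  exact: phi_inj.
by rewrite /= imset_f ?phiF.
Qed.

(** The graph is the bipartite graph of the family: its vertices are the elements,
    the indices of the sets, and one isolated vertex [rshift n ord_max], which
    keeps A nonempty even when n = 0. *)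
Lemma transversal_is_matching n t (F : 'I_t -> {set 'I_n}) B0 :
    full_transversal [set: 'I_t] F B0 ->
  exists (g : rel 'I_(n + t.+1)) (A : {set 'I_(n + t.+1)}),
    [/\ ssrbool.symmetric g, irreflexive g, A != set0
      & forall B', B' \in match_bases g A <->
        exists2 B, full_transversal [set: 'I_t] F B & B' = lshift t.+1 @: B].
Proof.
move=> [phi0 [phi0_inj phi0F _]].
pose r (j : 'I_t) : 'I_(n + t.+1) := rshift n (widen_ord (leqnSn t) j).
have r_inj : injective r by move=> i j /rshift_inj/(congr1 val)/=/val_inj.
have lr i j : (lshift t.+1 i == r j) = false.
  by apply/eqP=> /(congr1 val)/= eq_ij; have := ltn_ord i; rewrite eq_ij ltnNge leq_addr.
pose adj x y := [exists j, exists i in F j, (x == lshift t.+1 i) && (y == r j)].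
pose g x y := adj x y || adj y x; pose A := ~: (r @: setT).
have adjP i j : i \in F j -> adj (lshift t.+1 i) (r j).
  by move=> Fi; apply/existsP; exists j; apply/exists_inP; exists i; rewrite ?eqxx.
have g_sym : ssrbool.symmetric g by move=> x y; rewrite /g orbC.
have g_irr : irreflexive g.
  move=> x; rewrite /g orbb /adj; apply/negbTE/negP.
  move=> /existsP[j /exists_inP[i _ /andP[/eqP->]]].
  by rewrite lr.
have lA i : lshift t.+1 i \in A.
  by rewrite inE; apply/imsetP=> -[j _ /eqP]; rewrite lr.
exists g, A; split=> //.
  apply/set0Pn; exists (rshift n ord_max); rewrite inE; apply/imsetP=> -[j _].
  by move/rshift_inj/(congr1 val)=> /= eq_tj; have := ltn_ord j; rewrite -eq_tj ltnn.
move=> B'; rewrite -(transversal_imset F _ (@lshift_inj n t.+1)).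
apply: match_bases_transversal => {}B'.
  case/(transversal_imset F _ (@lshift_inj n t.+1))=> _ [phi [phi_inj phiF ->]] ->.
  rewrite inE; apply/andP; split.
    by apply/subsetP=> _ /imsetP[_ /imsetP[j _ ->] ->].
  pose e j := [set lshift t.+1 (phi j); r j].
  apply/existsP; exists (e @: setT); rewrite /matching -andbA; apply/and3P; split.
  - apply/subsetP=> _ /imsetP[j _ ->]; rewrite inE; apply/existsP.
    exists (lshift t.+1 (phi j)); apply/existsP; exists (r j).
    by rewrite eqxx andbT /g adjP ?phiF.
  - apply/trivIsetP=> _ _ /imsetP[i _ ->] /imsetP[j _ ->]; apply: contraNT.
    case/pred0Pn=> z /= /andP[/set2P[]-> /set2P[]/eqP]; rewrite ?lr //.
    + by rewrite (inj_eq (@lshift_inj _ _)) => /eqP/phi_inj->.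
    + by rewrite eq_sym lr.
    by rewrite (inj_eq r_inj) => /eqP->.
  apply/subsetP=> _ /imsetP[_ /imsetP[j _ ->] ->]; apply/bigcupP.
  by exists (e j); rewrite ?imset_f ?set21.
case/(match_indepP g_sym g_irr)=> sBA [m [mK mg] mB].
have neigh b : b \in B' -> exists i j, [/\ i \in F j, b = lshift t.+1 i & m b = r j].
  move=> Bb; have /mg/andP[+ _] := mB b Bb.
  rewrite /g /adj; case/orP=> /existsP[j /exists_inP[i Fi /andP[/eqP eq1 /eqP eq2]]].
    by exists i, j.
  by have := subsetP sBA b Bb; rewrite eq2 inE imset_f.
have full0 : full_transversal [set: 'I_t] F (phi0 @: setT) by exists phi0.
(* The default value j0 below needs an index, so B' is taken nonempty. *)
have [B0' | [b0 Bb0]] := set_0Vmem B'.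
  exists (lshift t.+1 @: (phi0 @: setT)); last by rewrite B0' sub0set.
  by apply/transversal_imset; [exact: lshift_inj | exists (phi0 @: setT)].
have [_ [j0 _]] := neigh b0 Bb0.
pose h i := odflt j0 [pick j | m (lshift t.+1 i) == r j].
have hP i : lshift t.+1 i \in B' -> i \in F (h i) /\ m (lshift t.+1 i) = r (h i).
  case/neigh=> i' [j [Fi /lshift_inj eqi eqm]]; rewrite -eqi in Fi.
  rewrite /h; case: pickP => [j' | /(_ j)]; rewrite eqm ?eqxx //=.
  by move/eqP/r_inj <-.
have [||||phi [phi_inj phiF sB']] := @mendelsohn_dulmage _ _ (fun j i => i \in F j)
    [set: 'I_t] [set i | lshift t.+1 i \in B'] phi0 h.
- by [].
- by [].
- move=> i i'; rewrite !inE => Bi Bi' eqh; apply: (@lshift_inj _ t.+1).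
  by apply: (inv_inj mK); rewrite (hP i Bi).2 (hP i' Bi').2 eqh.
- by move=> i; rewrite inE => /hP[].
exists (lshift t.+1 @: (phi @: setT)).
  by apply/transversal_imset; [exact: lshift_inj | exists (phi @: setT); first exists phi].
apply/subsetP=> b Bb; have [i [_ [_ eqb _]]] := neigh b Bb; rewrite eqb.
by apply/imset_f/(subsetP sB'); rewrite inE -eqb.
Qed.

End MatchingMatroids.

(** * Monomial ideals *)

Import GRing.Theory.
Local Open Scope ring_scope.
Local Open Scope classical_set_scope.

Section MonomialIdeals.

Variables (K : fieldType) (n : nat).
Local Notation S := {mpoly K[n]}.
Local Notation monomials_gen := (@monomials_gen K n).
Implicit Types (M N : set 'X_{1..n}) (I J X : set S).

Lemma ideal_gen_ideal X : is_ideal (ideal_gen X).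
Proof.
split=> [J [] // | p q Xp Xq J idJ sXJ | r p Xp J idJ sXJ]; have [J0 JD JM] := idJ.
- by apply: JD; [apply: Xp | apply: Xq].
- by apply: JM; apply: Xp.
Qed.

Lemma sub_ideal_gen X : X `<=` ideal_gen X.
Proof. by move=> p Xp J _; apply. Qed.

Lemma ideal_gen_min X J : is_ideal J -> X `<=` J -> ideal_gen X `<=` J.
Proof. by move=> idJ sXJ p; apply. Qed.

(** The polynomials described on the right form an ideal, since the monomials of a
    product are products of monomials. *)
Lemma monomials_genP M p :
  monomials_gen M p <->
  forall m, m \in msupp p -> exists2 m', M m' & (m' <= m)%MM.
Proof.
split=> [genp | suppM J idJ sMJ].
  pose J : set S := [set q | forall m, m \in msupp q -> exists2 m', M m' & (m' <= m)%MM].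
  apply: (genp J) => [| _ [m Mm ->] m']; last first.
    by rewrite msuppX inE => /eqP ->; exists m; rewrite ?lepm_refl.
  split=> [m | q r Jq Jr m | r q Jq m]; first by rewrite msupp0.
    by move/msuppD_le; rewrite mem_cat => /orP[/Jq | /Jr].
  case/msuppM_le/allpairsP=> -[m1 m2] /= [_ /Jq[m' Mm' le_m'] ->].
  by exists m' => //; apply: lepm_trans le_m' (lem_addl _ _).
have [J0 JD JM] := idJ; rewrite (mpolyE p) big_seq.
apply: big_ind => // m /suppM[m' Mm' le_m'].
rewrite -mul_mpolyC -(submK le_m') mpolyXD mulrA; apply: JM.
by apply: sMJ; exists m'.
Qed.

Lemma monomials_genX M m :
  monomials_gen M 'X_[m] <-> exists2 m', M m' & (m' <= m)%MM.
Proof.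
rewrite monomials_genP; split=> [/(_ m) | Mm m']; first by apply; rewrite msuppX inE.
by rewrite msuppX inE => /eqP ->.
Qed.

Lemma sub_monomials_gen M N :
    (forall m, M m -> exists2 m', N m' & (m' <= m)%MM) ->
  monomials_gen M `<=` monomials_gen N.
Proof.
move=> sMN; apply: ideal_gen_min (ideal_gen_ideal _) _ => _ [m Mm ->].
exact/monomials_genX/sMN.
Qed.

Lemma ideal_mul_monomials M N :
  ideal_mul (monomials_gen M) (monomials_gen N) =
  monomials_gen [set m | exists a b, [/\ M a, N b & m = (a + b)%MM]].
Proof.
rewrite eqEsubset; split; apply: ideal_gen_min (ideal_gen_ideal _) _.
  move=> _ [p [q [/monomials_genP Mp /monomials_genP Nq ->]]].
  apply/monomials_genP => m /msuppM_le/allpairsP[[m1 m2] /=].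
  case=> /Mp[a Ma le_a] /Nq[b Nb le_b] ->.
  exists (a + b)%MM; first by exists a, b.
  by apply/mnm_lepP=> i; rewrite !mnmDE leq_add //; apply/mnm_lepP.
move=> _ [_ [a [b [Ma Nb ->]]] ->]; apply: sub_ideal_gen; exists 'X_[a], 'X_[b].
by split; [apply: sub_ideal_gen; exists a | apply: sub_ideal_gen; exists b | rewrite mpolyXD].
Qed.

Lemma prime_monomials (F : {set 'I_n}) :
  ideal_gen [set p : S | exists2 i, i \in F & p = 'X_i] =
  monomials_gen [set m | exists2 i, i \in F & m = U_(i)%MM].
Proof.
congr ideal_gen; apply/seteqP; split=> [_ [i Fi ->] | _ [_ [i Fi ->] ->]].
  by exists U_(i)%MM => //; exists i.
by exists i.
Qed.

Lemma prod_primes_monomials t (F : 'I_t -> {set 'I_n}) :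
  \big[@ideal_mul K n/setT]_(i < t)
      ideal_gen [set p : S | exists2 j, j \in F i & p = 'X_j] =
  monomials_gen [set m | exists2 phi : 'I_t -> 'I_n,
                   forall i, phi i \in F i & m = (\sum_(i < t) U_(phi i))%MM].
Proof.
elim: t F => [|t IHt] F.
  rewrite big_ord0; apply/esym/seteqP; split=> // p _; apply/monomials_genP => m _.
  exists 0%MM; last by apply/mnm_lepP=> i; rewrite mnm0E.
  have phi : 'I_0 -> 'I_n by case.
  by exists phi; [case | rewrite big_ord0].
rewrite big_ord_recl IHt prime_monomials ideal_mul_monomials; congr monomials_gen.
apply/seteqP; split=> [_ [_ [_ [[j Fj ->] [phi phiF ->] ->]]] | _ [phi phiF ->]].
  exists (fun i => oapp phi j (unlift ord0 i)) => [i |].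
    by case: unliftP => [k | ] -> //=; apply: phiF.
  rewrite big_ord_recl unlift_none /=; congr (_ + _)%MM.
  by apply: eq_bigr => k _; rewrite liftK.
exists U_(phi ord0)%MM, (\sum_(i < t) U_(phi (lift ord0 i)))%MM; split.
- by exists (phi ord0).
- by exists (phi \o lift ord0) => // i; apply: phiF.
by rewrite big_ord_recl.
Qed.

Lemma mesym1E (B : {set 'I_n}) : mesym1 B = (\sum_(i in B) U_(i))%MM.
Proof.
apply/mnmP=> j; rewrite mnm_sumE mnmE big_mkcond (bigD1 j) //= mnm1E eqxx.
rewrite big1 ?addn0; first by case: ifP.
by move=> i /negPf neq_ij; rewrite mnm1E neq_ij if_same.
Qed.

Lemma lem_mesym1 (B C : {set 'I_n}) : (mesym1 B <= mesym1 C)%MM = (B \subset C).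
Proof.
apply/mnm_lepP/fintype.subsetP => [le_BC i Bi | sBC i]; last first.
  by rewrite !mnmE; case: (boolP (i \in B)) => // /sBC ->.
by have := le_BC i; rewrite !mnmE Bi; case: (i \in C).
Qed.

Lemma mesym1_squarefree (B : {set 'I_n}) : squarefree_mnm (mesym1 B).
Proof. by move=> i; rewrite mnmE; case: (i \in B). Qed.

Lemma mesym1_supp (m : 'X_{1..n}) : squarefree_mnm m -> mesym1 (mnm_supp m) = m.
Proof.
by move=> sqf_m; apply/mnmP=> i; rewrite mnmE finset.inE; case: (m i) (sqf_m i) => [|[]].
Qed.

Lemma mnm_supp_mesym1 (B : {set 'I_n}) : mnm_supp (mesym1 B) = B.
Proof. by apply/setP=> i; rewrite finset.inE mnmE; case: (i \in B). Qed.

Definition squarefree_ideal (Bs : set {set 'I_n}) : set S :=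
  monomials_gen [set mesym1 B | B in Bs].

(** A sum of variables U_(phi i) is squarefree exactly when phi is injective, and
    every squarefree monomial above it is generated by it. *)
Lemma squarefree_part_prod t (F : 'I_t -> {set 'I_n}) :
  squarefree_part (\big[@ideal_mul K n/setT]_(i < t)
      ideal_gen [set p : S | exists2 j, j \in F i & p = 'X_j]) =
  squarefree_ideal [set B | full_transversal finset.setT F B].
Proof.
have sumU (phi : 'I_t -> 'I_n) : injective phi ->
    (\sum_(i < t) U_(phi i))%MM = mesym1 (phi @: finset.setT)%SET.
  move=> phi_inj; rewrite mesym1E big_imset /=; last by move=> i j _ _; apply: phi_inj.
  by apply: eq_bigl => i; rewrite finset.inE.
rewrite prod_primes_monomials eqEsubset; split; apply: sub_monomials_gen.
  move=> m [/monomials_genX[_ [phi phiF ->] le_m] sqf_m].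
  have phi_inj : injective phi.
    move=> i j eq_ij; apply: contraTeq isT => neq_ij.
    have := leq_trans (mnm_lepP le_m (phi i)) (sqf_m (phi i)).
    rewrite mnm_sumE (bigD1 i) //= (bigD1 j) 1?eq_sym //= !mnm1E eq_ij eqxx.
    by rewrite addnA.
  exists (mesym1 (phi @: finset.setT)%SET); last by rewrite -sumU.
  exists (phi @: finset.setT)%SET => //.
  by exists phi; split=> [i j _ _ | i _ |] //; apply: phi_inj.
move=> _ [_ [phi [phi_inj phiF ->]] <-].
have {}phi_inj : injective phi by move=> i j; apply: phi_inj; rewrite finset.inE.
exists (mesym1 (phi @: finset.setT)%SET); last exact: lepm_refl.
split; last exact: mesym1_squarefree.
apply/monomials_genX; exists (\sum_(i < t) U_(phi i))%MM.
  by exists phi => // i; apply: phiF; rewrite finset.inE.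
by rewrite sumU ?lepm_refl.
Qed.

Lemma lepm_antisym (a b : 'X_{1..n}) : (a <= b)%MM -> (b <= a)%MM -> a = b.
Proof.
move=> /mnm_lepP le_ab /mnm_lepP le_ba; apply/mnmP=> i.
by apply/eqP; rewrite eqn_leq le_ab le_ba.
Qed.

(** Any generating set of monomials contains the elements of M, because each of
    them can be a multiple of no other monomial of the ideal. *)
Lemma min_gens_antichain M :
    (forall a b, M a -> M b -> (a <= b)%MM -> a = b) ->
  min_gens (monomials_gen M) = M.
Proof.
move=> antiM; have gen_sub N : monomials_gen M = monomials_gen N ->
    forall m, M m -> exists2 m', N m' & (m' <= m)%MM.
  move=> eqMN m Mm; apply/(monomials_genX N); rewrite -eqMN.
  by apply/monomials_genX; exists m; rewrite ?lepm_refl.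
apply/seteqP; split=> [u [N [eqMN minN] Nu] | m Mm]; last first.
  exists M => //; split=> // N sNM eqMN; apply/seteqP; split=> // {}m {}Mm.
  have [m' Nm' le_m'] := gen_sub N eqMN m Mm.
  by rewrite -(antiM m' m) //; apply: sNM.
suff eqM : M = N by rewrite eqM.
apply: minN => // m Mm; have [m' Nm' le_m'] := gen_sub N eqMN m Mm.
have [m2 Mm2 le_m2] : exists2 m2, M m2 & (m2 <= m')%MM.
  apply/monomials_genX; rewrite eqMN.
  by apply/monomials_genX; exists m'; rewrite ?lepm_refl.
have eq_m2 : m2 = m by apply: antiM => //; apply: lepm_trans le_m2 le_m'.
by rewrite -(lepm_antisym le_m') // -eq_m2.
Qed.

(** The minimal elements of a set of monomials generate the same ideal, by descent
    on the degree, and form an antichain. *)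
Lemma squarefree_min_gens I : squarefree_monomial_ideal I ->
  min_gens I `<=` @squarefree_mnm n /\ I = monomials_gen (min_gens I).
Proof.
move=> [M sqfM ->]; pose M0 := [set m | M m /\ forall m', M m' -> (m' <= m)%MM -> m' = m].
have eqM : monomials_gen M = monomials_gen M0.
  rewrite eqEsubset; split; apply: sub_monomials_gen => m; last first.
    by case=> Mm _; exists m; rewrite ?lepm_refl.
  have [k] := ubnP (mdeg m); elim: k m => // k IHk m le_mk Mm.
  have [[m' [Mm' le_m' neq_m']] | minm] :=
      pselect (exists m', [/\ M m', (m' <= m)%MM & m' <> m]).
    have [|m0 M0m0 le_m0] := IHk m' _ Mm'.
      rewrite -ltnS; apply: leq_trans le_mk; rewrite ltnS -(submK le_m') mdegD.
      rewrite -[X in (X < _)%N]add0n ltn_add2r lt0n mdeg_eq0.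
      apply/eqP=> eq0; apply: neq_m'; rewrite -(submK le_m') eq0.
      by apply/mnmP=> i; rewrite mnmDE mnm0E.
    by exists m0; last exact: lepm_trans le_m0 le_m'.
  exists m; last exact: lepm_refl; split=> // m' Mm' le_m'.
  by apply: contrapT => neq_m'; apply: minm; exists m'.
rewrite {1 2 3}eqM min_gens_antichain //; last first.
  by move=> a b [Ma _] [_ minb]; apply: minb.
by split=> // m [/sqfM].
Qed.

End MonomialIdeals.

(** * Matching-matroidal ideals *)

Theorem theorem4p3 (K : fieldType) (n : nat) (I : set {mpoly K[n]})
    (I_monomial : monomial_ideal I) (I_neq0 : I <> [set 0]) :
  matching_matroidal I <->
  exists (t : nat) (P : 'I_t -> set {mpoly K[n]}),
    (forall i, monomial_prime (P i)) /\
    I = squarefree_part (\big[@ideal_mul K n/setT]_(i < t) P i).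
Proof.
split=> [[sqfI [k [g [A [g_sym g_irr _ basesE]]]]] | [t [P [primeP IE]]]].
  have [t [F presF]] := match_bases_presentation A g_sym g_irr.
  have baseP B : full_transversal finset.setT F B <->
      exists2 u, min_gens I u & B = [set lshift k i | i in mnm_supp u]%SET.
    by rewrite -presF; have := congr1 (fun X => X B) basesE; rewrite /mkset => ->.
  have [B0 /presF transB0] := match_bases_exist g A.
  pose F' j : {set 'I_n} := (lshift k @^-1: F j)%SET.
  (* Bases lie in the image of lshift, and every element of the sets F j lies in
     a base, so the sets F j come from subsets of 'I_n. *)
  have FE : F = fun j => (lshift k @: F' j)%SET.
    apply/funext=> j; apply/setP=> x; apply/idP/imsetP=> [Fx | [i]]; last first.
      by rewrite !finset.inE => Fi ->.
    have [_ /baseP[u _ ->] /imsetP[i _ eqx]] :=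
      transversal_through transB0 (finset.in_setT j) Fx.
    by exists i; rewrite // finset.inE -eqx.
  have transE B : full_transversal finset.setT F' B <->
      exists2 u, min_gens I u & B = mnm_supp u.
    have lshiftI : injective (fun C : {set 'I_n} => lshift k @: C)%SET.
      exact: imset_inj (@lshift_inj n k).
    split=> [transB | [u genu ->]].
      have /baseP[u genu /lshiftI eqB] : full_transversal finset.setT F (lshift k @: B)%SET.
        by rewrite FE; apply/transversal_imset; [exact: lshift_inj | exists B].
      by exists u.
    have /baseP : exists2 v, min_gens I v &
        (lshift k @: mnm_supp u)%SET = [set lshift k i | i in mnm_supp v]%SET by exists u.
    rewrite FE => /transversal_imset-/(_ (@lshift_inj n k))[C transC /lshiftI ->].
    exact: transC.
  have [sqf_gens IE] := squarefree_min_gens sqfI.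
  exists t, (fun j => ideal_gen [set p | exists2 i, i \in F' j & p = 'X_i]); split.
    move=> j; exists (F' j) => //; have := transB0; rewrite FE.
    case=> phi [_ /(_ j (finset.in_setT j))/imsetP[i F'i _] _].
    by apply/set0Pn; exists i.
  rewrite squarefree_part_prod {1}IE /squarefree_ideal; congr monomials_gen.
  apply/seteqP; split=> [u genu | _ [B /transE[u genu ->] <-]].
    by exists (mnm_supp u); [apply/transE; exists u | apply/mesym1_supp/sqf_gens].
  by rewrite mesym1_supp //; apply: sqf_gens.
have [F FP] : exists F : 'I_t -> {set 'I_n}, forall j,
    P j = ideal_gen [set p | exists2 i, i \in F j & p = 'X_i].
  have /choice[F FP] j : exists Fj : {set 'I_n},
      P j = ideal_gen [set p | exists2 i, i \in Fj & p = 'X_i].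
    by have [Fj _ ->] := primeP j; exists Fj.
  by exists F.
pose Bs := [set B | full_transversal finset.setT F B].
have {}IE : I = squarefree_ideal Bs.
  by rewrite IE -squarefree_part_prod; congr squarefree_part; apply: eq_bigr.
have [B0 transB0] : exists B0, Bs B0.
  apply: contrapT => noB; apply: I_neq0; rewrite IE; apply/seteqP; split=> p.
    move/monomials_genP => suppp; apply/eqP; rewrite -msupp_eq0.
    case: (msupp p) suppp => // m s /(_ m); rewrite inE eqxx => -[] // m' [B BsB _] _.
    by case: noB; exists B.
  by move->; apply/monomials_genP => m; rewrite msupp0.
have gensI : min_gens I = [set mesym1 B | B in Bs].
  rewrite IE; apply: min_gens_antichain => _ _ [B transB <-] [C transC <-].
  rewrite lem_mesym1 => sBC; congr mesym1; apply/eqP.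
  by rewrite finset.eqEcard sBC (card_transversal transB) (card_transversal transC) /=.
have [g [A [g_sym g_irr An0 basesE]]] := transversal_is_matching transB0.
split; first by exists [set mesym1 B | B in Bs] => // _ [B _ <-]; apply: mesym1_squarefree.
exists t.+1, g, A; split=> //; apply/seteqP; split=> [_ /basesE[B transB ->] | _ [u genu ->]].
  by exists (mesym1 B); rewrite ?mnm_supp_mesym1 // gensI; exists B.
apply/basesE; move: genu; rewrite gensI => -[B transB <-].
by exists B; rewrite ?mnm_supp_mesym1.
Qed.
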